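(* Let $K$ be a field with $\operatorname{char}K\neq 2$, let $D\in K^\times$, and let $M$ be the cyclic Galois module of order $4$ corresponding to the quadratic extension $K[\sqrt{D}]$, i.e. $M=\mathbb{Z}/4\mathbb{Z}$ with $g\in G_K$ acting by multiplication by $\chi_D(g)=g(\sqrt{D})/\sqrt{D}\in\{\pm1\}$. Then there is a group isomorphism $$H^1(K,M)\cong\{(\alpha,c)\in K[\sqrt{-D}]^\times\times K^\times : N(\alpha)=c^4\}\big/\{(\beta^4,N(\beta)) : \beta\in K[\sqrt{-D}]^\times\}$$ in which the coclass corresponding to a pair $(a+b\sqrt{-D},c)$ ($a,b,c\in K$) has corresponding quartic algebra $$L=K\Big[\sqrt{2a+2c^2},\ \sqrt{2c+\sqrt{2a+2c^2}}\Big].$$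
   Context: $N$ denotes the norm from $K[\sqrt{-D}]=K[X]/(X^2+D)$ to $K$. $K^{\mathrm{sep}}$ is a separable closure and $G_K$ its absolute Galois group. The quartic algebra $L$ is the iterated adjunction $K[u,v]/(u^2-(2a+2c^2),\,v^2-(2c+u))$. The correspondence between $H^1(K,M)$ and quartic étale algebras is: a coclass represented by a crossed homomorphism $\sigma:G_K\to M$ (i.e. $\sigma(gh)=\sigma(g)+g\sigma(h)$) corresponds to the étale algebra $L$ of degree $4$ whose coordinates ($K$-algebra maps $L\to K^{\mathrm{sep}}$) admit a labeling $\{\iota_x\}_{x\in M}$ with $g\circ\iota_x=\iota_{gx+\sigma(g)}$ for all $g\in G_K$; i.e. $L$ is the $\operatorname{Hol}(\mathbb{Z}/4)\cong D_4$-extension associated to $g\mapsto(x\mapsto gx+\sigma(g))$.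
   Formalization: The claim on the quartic algebra L is asserted only for pairs with a ≠ c² and a ≠ −c²; otherwise L as presented is not étale (for (α,c) = (1,1) it has only three coordinates), so it cannot correspond to a coclass. *)

(* Defs.v *)
From HB Require Import structures.
From mathcomp Require Import all_boot all_order all_algebra all_field.
Set Implicit Arguments. Unset Strict Implicit. Unset Printing Implicit Defensive.
Import GRing.Theory.
Local Open Scope ring_scope.

Section Defs.
Variables (K L : fieldType) (f : {rmorphism K -> L}).

Definition is_sep_closure : Prop :=
  (forall p : {poly L}, (1 < size p)%N -> separable_poly p -> exists x, root p x) /\
  (forall x : L, exists p : {poly K},
      [/\ p != 0, separable_poly p & root (map_poly f p) x]).

Definition in_GK (g : L -> L) : Prop :=
  [/\ forall x y, g (x + y) = g x + g y,
      forall x y, g (x * y) = g x * g y,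
      g 1 = 1,
      bijective g
    & forall k, g (f k) = f k].

(* r is a chosen square root of D in K^sep; the action of g on M = Z/4 is
   multiplication by chi_D(g) = g(r)/r in {+1,-1}. *)
Variable r : L.
Definition chiact (g : L -> L) (x : 'Z_4) : 'Z_4 := if g r == r then x else - x.

Definition crossed_hom (s : (L -> L) -> 'Z_4) : Prop :=
  forall g h, in_GK g -> in_GK h -> s (g \o h) = s g + chiact g (s h).

(* continuity for the Krull topology with M discrete: s factors through the
   restriction to a finitely generated subextension K(S). *)
Definition loc_const (s : (L -> L) -> 'Z_4) : Prop :=
  exists S : seq L, forall g h, in_GK g -> in_GK h ->
    (forall x, x \in S -> g x = h x) -> s g = s h.

Definition cocycle (s : (L -> L) -> 'Z_4) : Prop := crossed_hom s /\ loc_const s.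

Definition coboundary (s : (L -> L) -> 'Z_4) : Prop :=
  exists m : 'Z_4, forall g, in_GK g -> s g = chiact g m - m.

Definition cohomologous (s t : (L -> L) -> 'Z_4) : Prop :=
  coboundary (fun g => s g - t g).

(* K-algebra maps  K[u,v]/(u^2-(2a+2c^2), v^2-(2c+u)) -> K^sep,
   identified with the images (u0, v0) of the generators. *)
Definition is_Lhom (a c : K) (uv : L * L) : Prop :=
  uv.1 ^+ 2 = f (2 * a + 2 * c ^+ 2) /\ uv.2 ^+ 2 = f (2 * c) + uv.1.

(* the coclass of s corresponds to L: the coordinates of L admit a labeling
   by M with g o iota_x = iota_{g x + s g}. *)
Definition labels (s : (L -> L) -> 'Z_4) (a c : K) : Prop :=
  exists iota : 'Z_4 -> L * L,
    [/\ injective iota,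
        forall x, is_Lhom a c (iota x),
        forall uv, is_Lhom a c uv -> exists x, iota x = uv
      & forall g x, in_GK g ->
          (g (iota x).1, g (iota x).2) = iota (chiact g x + s g)].
End Defs.

Section Quad.
Variables (K : fieldType) (D : K).
(* K[sqrt(-D)] = K[X]/(X^2 + D); the pair (a, b) stands for a + b sqrt(-D). *)
Definition qmul (x y : K * K) : K * K :=
  (x.1 * y.1 - D * (x.2 * y.2), x.1 * y.2 + x.2 * y.1).
Definition qnorm (x : K * K) : K := x.1 ^+ 2 + D * x.2 ^+ 2.
Definition qpow4 (x : K * K) : K * K := let x2 := qmul x x in qmul x2 x2.

Definition inP (p : (K * K) * K) : Prop :=
  qnorm p.1 != 0 /\ p.2 != 0 /\ qnorm p.1 = p.2 ^+ 4.
Definition pmul (p q : (K * K) * K) : (K * K) * K := (qmul p.1 q.1, p.2 * q.2).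
Definition inS (p : (K * K) * K) : Prop :=
  exists beta : K * K, [/\ qnorm beta != 0, p.1 = qpow4 beta & p.2 = qnorm beta].
End Quad.

(* Main.v *)
(* With [w = sqrt(-D)] and [A = K[w]], the module [M] is the group of fourth
   roots of unity twisted by the quadratic character of [K(w)], that is, the
   kernel of [beta |-> (beta^4, N beta)] from the units of
   [A (x) Ksep = Ksep * Ksep] onto the pairs [(alpha, c)] with [N alpha = c^4],
   an element [n] of [M] being [(i^n, i^-n)].  A pair [p] has a fourth root
   [beta], and its class sends [g] to [g(beta) / beta].  Galois descent gives the
   kernel.  Surjectivity is Hilbert's theorem 90 for the units of [A (x) Ksep],
   by a Poincare series that Artin's independence of characters makes nonzero.
   That the fixed field is [K] needs an extension of embeddings to [Ksep]: apply
   Zorn's lemma to the subrings of [Ksep * Ksep] that contain the diagonal of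
   [K] and are graphs. *)
Require Import Defs.
From HB Require Import structures.
From mathcomp Require Import all_boot all_order all_algebra all_field.
From mathcomp Require Import boolp classical_sets ring.
Set Implicit Arguments.
Unset Strict Implicit.
Unset Printing Implicit Defensive.
Import GRing.Theory.
Local Open Scope ring_scope.

(** * Conjugates of an element algebraic over a subfield *)

Definition sep_closed (L : fieldType) : Prop :=
  forall p : {poly L}, (1 < size p)%N -> separable_poly p -> exists x, root p x.

(** Euclidean descent: if [h] does not divide some annihilator [q], then [q %% h] is a nonzero
    annihilator of smaller size. *)
Lemma annihilator_generator (F L : fieldType) (i : {rmorphism F -> L}) (x : L)
    (h : {poly F}) :
  h != 0 -> root (map_poly i h) x ->
  exists p : {poly F}, [/\ p != 0, root (map_poly i p) x
    & forall q, root (map_poly i q) x -> p %| q].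
Proof.
elim: {h}(size h) {-2}h (leqnn (size h)) => [|n IHn] h.
  by rewrite leqn0 size_poly_eq0 => ->.
move=> szh h0 hx.
have [[q qx hq]|noq] :=
    pselect (exists2 q, root (map_poly i q) x & ~~ (h %| q)); last first.
  exists h; split=> // q qx; case: (boolP (h %| q)) => // hq.
  by case: noq; exists q.
apply: (IHn (q %% h)) => //.
- by rewrite -ltnS (leq_trans _ szh) // ltn_modp.
- rewrite /root map_modp; move: qx.
  rewrite /root {1}(divp_eq (map_poly i q) (map_poly i h)) hornerD hornerM.
  by rewrite (eqP (hx : _ == 0)) mulr0 add0r.
Qed.

(** The minimal polynomial of [x] divides [h], so it is separable, and any root [y] of its image
    under [s] will do. This is what extending [s] by [x |-> y] requires. *)
Lemma root_transfer (F L : fieldType) (i s : {rmorphism F -> L}) (x : L)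
    (h : {poly F}) :
  sep_closed L -> separable_poly h -> root (map_poly i h) x ->
  exists y, forall q, root (map_poly i q) x -> root (map_poly s q) y.
Proof.
move=> Lcl hsep hx.
have [p [p0 px pdiv]] := annihilator_generator (separable_poly_neq0 hsep) hx.
have psep : separable_poly p by apply: dvdp_separable (pdiv _ hx) hsep.
have [||y py] := Lcl (map_poly s p).
- rewrite size_map_poly ltnNge; apply/negP => /size1_polyC pC.
  move: px p0; rewrite pC map_polyC /root hornerC fmorph_eq0 => /eqP ->.
  by rewrite eqxx.
- by rewrite separable_map.
exists y => q /pdiv /dvdpP [t ->].
by rewrite rmorphM /= rootM py orbT.
Qed.

(** Write the minimal polynomial as [t * ('X - x%:P)]. If [t] were constant, [x] would lie in [K];
    so [t] has a root, which separability keeps apart from [x]. *)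
Lemma other_conjugate (K L : fieldType) (f : {rmorphism K -> L}) (x : L)
    (h : {poly K}) :
  sep_closed L -> separable_poly h -> root (map_poly f h) x ->
  ~ (exists k, x = f k) ->
  exists2 y, y != x & forall q, root (map_poly f q) x -> root (map_poly f q) y.
Proof.
move=> Lcl hsep hx xK.
have [p [p0 px pdiv]] := annihilator_generator (separable_poly_neq0 hsep) hx.
have psep : separable_poly (map_poly f p).
  by rewrite separable_map; apply: dvdp_separable (pdiv _ hx) hsep.
have /factor_theorem [t pE] := px.
have t0 : t != 0.
  by apply: contraNneq p0 => t0; rewrite -(map_poly_eq0 f) pE t0 mul0r.
have tsep : separable_poly t.
  by apply: dvdp_separable psep; rewrite pE dvdp_mulr.
have [|//|y ty] := Lcl t.
  rewrite ltnNge; apply/negP => szt; apply: xK.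
  have szp : size p = 2%N.
    rewrite -(size_map_poly f) pE size_Mmonic ?monicXsubC // size_XsubC.
    by move: szt; rewrite -size_poly_gt0 in t0; case: (size t) t0 => [|[|]].
  exists (- p`_0 / p`_1).
  move: px; rewrite /root horner_coef size_map_poly szp big_ord_recl big_ord1.
  rewrite !coef_map /= expr0 mulr1 expr1.
  have p1 : p`_1 != 0 by move: p0; rewrite -lead_coef_eq0 lead_coefE szp.
  rewrite addr_eq0 fmorph_div rmorphN /= => /eqP ->.
  by rewrite opprK mulrAC mulfV ?mul1r // fmorph_eq0.
exists y.
  apply: contraTneq ty => ->.
  have /separable_coprime : separable_poly (map_poly f p) by [].
  move=> /(_ t ('X - x%:P)); rewrite -pE dvdpp => /(_ isT).
  by rewrite coprimep_XsubC.
move=> q /pdiv /dvdpP [u ->].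
by rewrite rmorphM /= pE rootM rootM ty orbT.
Qed.

(** * Partial embeddings over [K], encoded by their graphs *)

Section Graph.
Variables (K L : fieldType) (f : {rmorphism K -> L}).

(** With graphs, extension is inclusion and chains have unions. Given closure under subtraction, the
    last condition makes [R] single-valued. *)
Definition partial_emb (R : set (L * L)) : Prop :=
  [/\ forall k, R (f k, f k),
      forall u v, R u -> R v -> R (u - v),
      forall u v, R u -> R v -> R (u * v)
    & forall y, R (0, y) -> y = 0].

(** The graph of [F[x] -> L] extending [s] by [x |-> y]; the root condition makes it well defined.
    It is used with [F = K] to start an embedding and with [F] the domain of an embedding to enlarge
    it. *)
Lemma partial_emb_adjoin (F : fieldType) (i s : {rmorphism F -> L}) (x y : L) :
  (forall k, exists a, i a = f k /\ s a = f k) ->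
  (forall q, root (map_poly i q) x -> root (map_poly s q) y) ->
  partial_emb (fun u => exists q, u = ((map_poly i q).[x], (map_poly s q).[y])).
Proof.
move=> fis xy; split.
- move=> k; have [a [ia sa]] := fis k.
  by exists a%:P; rewrite !map_polyC !hornerC /= ia sa.
- move=> _ _ [p ->] [q ->]; exists (p - q).
  by rewrite !rmorphB !hornerD !hornerN.
- move=> _ _ [p ->] [q ->]; exists (p * q).
  by rewrite !rmorphM !hornerM.
- by move=> z [p [/esym /eqP /xy /eqP ->]].
Qed.

(** Zorn's lemma is applied to the sets whose union with [R0] is a partial embedding, so that the
    empty chain is covered too: its union gives [R0] itself. *)
Lemma partial_emb_maximal (R0 : set (L * L)) : partial_emb R0 ->
  exists R, [/\ partial_emb R, (R0 `<=` R)%classic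
    & forall R', partial_emb R' -> (R `<=` R')%classic -> (R' `<=` R)%classic].
Proof.
move=> R0e.
have [|A [Ae Amax]] :=
    @Zorn_bigcup _ [set A : set (L * L) | partial_emb (A `|` R0)%classic].
  move=> /= F Fe Ftot.
  have [[B0 FB0]|F0] := pselect (exists A, F A); last first.
    suff -> : (\bigcup_(X in F) X `|` R0 = R0)%classic by [].
    rewrite eqEsubset; split=> [u [[A FA]|//]|u]; last by right.
    by case: F0; exists A.
  have dir u v : ((\bigcup_(X in F) X) `|` R0)%classic u ->
      ((\bigcup_(X in F) X) `|` R0)%classic v ->
      exists2 A, F A & (A `|` R0)%classic u /\ (A `|` R0)%classic v.
    move=> [[A FA Au]|Ru] [[B FB Bv]|Rv].
    - have [AB|BA] := Ftot _ _ FA FB.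
        by exists B => //; split; left => //; apply: AB.
      by exists A => //; split; left => //; apply: BA.
    - by exists A => //; split; [left|right].
    - by exists B => //; split; [right|left].
    - by exists B0 => //; split; right.
  have up A u : F A -> (A `|` R0)%classic u ->
      ((\bigcup_(X in F) X) `|` R0)%classic u.
    by move=> FA [Au|]; [left; exists A|right].
  have [R0k _ _ _] := R0e; split.
  - by move=> k; right.
  - move=> u v /dir /[apply] -[A FA [Au Av]].
    by apply: (up A) => //; have [_ + _ _] := Fe _ FA; apply.
  - move=> u v /dir /[apply] -[A FA [Au Av]].
    by apply: (up A) => //; have [_ _ + _] := Fe _ FA; apply.
  - move=> y Hy; have [A FA [Ay _]] := dir _ _ Hy Hy.
    by have [_ _ _ A0] := Fe _ FA; exact: A0 Ay.
exists (A `|` R0)%classic; split; [exact: Ae|by move=> u ?; right|].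
move=> R' R'e AR' u R'u; apply: contrapT => nu.
apply: (Amax R'); last first.
  rewrite /mkset; suff -> : (R' `|` R0 = R')%classic by [].
  rewrite eqEsubset; split=> v; [case=> // ? |by left].
  by apply: AR'; right.
split; first by move=> v Av; apply: AR'; left.
by move=> R'A; apply: nu; left; apply: R'A.
Qed.

(** * The domain of a partial embedding is a field, and all of [L] in the maximal case *)

Section Domain.
Variable R : set (L * L).
Hypothesis Re : partial_emb R.
Hypothesis falg : forall x : L, exists p : {poly K},
      [/\ p != 0, separable_poly p & root (map_poly f p) x].

Lemma partial_emb_fun x y z : R (x, y) -> R (x, z) -> y = z.
Proof.
have [_ RB _ R0] := Re => Ry Rz; apply/eqP; rewrite -subr_eq0; apply/eqP/R0.
by have := RB _ _ Ry Rz; rewrite (_ : _ - _ = (0, y - z)) // -[0](subrr x).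
Qed.

Lemma partial_emb_diff x y x' y' : R (x, y) -> R (x', y') -> R (x - x', y - y').
Proof. by have [_ RB _ _] := Re => u v; apply: RB u v. Qed.

Lemma partial_emb_mul x y x' y' : R (x, y) -> R (x', y') -> R (x * x', y * y').
Proof. by have [_ _ RM _] := Re => u v; apply: RM u v. Qed.

Lemma partial_emb_add x y x' y' : R (x, y) -> R (x', y') -> R (x + x', y + y').
Proof.
have [Rk _ _ _] := Re; have := Rk 0; rewrite rmorph0 => R00.
move=> u v; rewrite -[x']opprK -[y']opprK -(sub0r (x')) -(sub0r y').
by apply: partial_emb_diff u (partial_emb_diff R00 v).
Qed.

Lemma partial_emb_horner x y (p : {poly K}) :
  R (x, y) -> R ((map_poly f p).[x], (map_poly f p).[y]).
Proof.
have [Rk _ _ _] := Re => u; elim/poly_ind: p => [|p c IH].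
  by rewrite rmorph0 !horner0 -(rmorph0 f).
rewrite rmorphD rmorphM /= map_polyX map_polyC /= !hornerMXaddC.
by apply: partial_emb_add => //; apply: partial_emb_mul.
Qed.

(** Since [x] is algebraic, its inverse is a polynomial in [x] over [K]; the same polynomial inverts
    [y], which satisfies the same relation. *)
Lemma partial_emb_inv x y : R (x, y) -> R (x^-1, y^-1).
Proof.
have [Rk _ _ R0] := Re => u.
have [x0|x0] := eqVneq x 0.
  have y0 : y = 0 by apply: R0; rewrite -x0.
  by rewrite x0 y0 !invr0 -(rmorph0 f).
have [p [p0 _ px]] := falg x.
(* Factors ['X] are removed from the annihilator until its constant term is nonzero. *)
have [q [c [c0 qx]]] : exists (q : {poly K}) c,
    c != 0 /\ root (map_poly f (q * 'X + c%:P)) x.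
  elim/poly_ind: p p0 px => [|p c IHp]; first by rewrite eqxx.
  have [->|c0 _ px] := eqVneq c 0; last by exists p, c.
  rewrite addr0 mulf_eq0 polyX_eq0 orbF => p0.
  rewrite rmorphM /= map_polyX rootM rootX (negPf x0) orbF => px.
  exact: IHp p0 px.
have qy : root (map_poly f (q * 'X + c%:P)) y.
  apply/eqP/R0; rewrite -(eqP (qx : _ == 0)).
  exact: partial_emb_horner.
have inv_eq z : root (map_poly f (q * 'X + c%:P)) z ->
    z^-1 = (map_poly f q).[z] * f (- c^-1).
  rewrite /root rmorphD rmorphM /= map_polyX map_polyC /= hornerMXaddC => /eqP qz.
  have z0 : z != 0.
    by apply: contra_eq_neq qz => ->; rewrite mulr0 add0r fmorph_eq0.
  move/eqP: qz; rewrite addr_eq0 => /eqP qz.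
  apply: (mulIf z0); rewrite mulVf // mulrAC qz -rmorphN -rmorphM mulrNN.
  by rewrite mulfV // rmorph1.
rewrite !inv_eq //; apply: partial_emb_mul => //; exact: partial_emb_horner.
Qed.

Definition emb_dom (x : L) : bool := `[< exists y, R (x, y) >].

Lemma emb_dom_divring_closed : divring_closed emb_dom.
Proof.
have [Rk _ _ _] := Re; split.
- by apply/asboolP; exists 1; rewrite -(rmorph1 f).
- move=> x y /asboolP [x' Rx] /asboolP [y' Ry]; apply/asboolP.
  by exists (x' - y'); apply: partial_emb_diff.
- move=> x y /asboolP [x' Rx] /asboolP [y' Ry]; apply/asboolP.
  by exists (x' / y'); apply: partial_emb_mul => //; apply: partial_emb_inv.
Qed.

HB.instance Definition _ :=
  GRing.isDivringClosed.Build L emb_dom emb_dom_divring_closed.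

Definition emb_field := {x : L | emb_dom x}.

HB.instance Definition _ := [isSub of emb_field for @sval L emb_dom].
HB.instance Definition _ := [Choice of emb_field by <:].
HB.instance Definition _ := [SubChoice_isSubIntegralDomain of emb_field by <:].
HB.instance Definition _ := [SubIntegralDomain_isSubField of emb_field by <:].

Definition emb_val (x : emb_field) : L := projT1 (cid (asboolP _ (valP x))).

Lemma emb_valP x : R (val x, emb_val x).
Proof. exact: (projT2 (cid (asboolP _ (valP x)))). Qed.

Lemma emb_val_eq x y : R (val x, y) -> emb_val x = y.
Proof. exact: partial_emb_fun (emb_valP x). Qed.

Lemma emb_val_zmod_morphism : zmod_morphism emb_val.
Proof.
move=> x y; apply: emb_val_eq; rewrite rmorphB.
by apply: partial_emb_diff; apply: emb_valP.
Qed.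

Lemma emb_val_monoid_morphism : monoid_morphism emb_val.
Proof.
have [Rk _ _ _] := Re; split=> [|x y]; apply: emb_val_eq.
  by rewrite rmorph1 -(rmorph1 f).
by rewrite rmorphM; apply: partial_emb_mul; apply: emb_valP.
Qed.

HB.instance Definition _ :=
  GRing.isZmodMorphism.Build emb_field L emb_val emb_val_zmod_morphism.
HB.instance Definition _ :=
  GRing.isMonoidMorphism.Build emb_field L emb_val emb_val_monoid_morphism.

Lemma emb_dom_base k : emb_dom (f k).
Proof. by have [Rk _ _ _] := Re; apply/asboolP; exists (f k). Qed.

Definition emb_base (k : K) : emb_field := Sub (f k) (emb_dom_base k).

Lemma emb_base_zmod_morphism : zmod_morphism emb_base.
Proof. by move=> x y; apply: val_inj; rewrite /= !rmorphB. Qed.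

Lemma emb_base_monoid_morphism : monoid_morphism emb_base.
Proof.
by split=> [|x y]; apply: val_inj; rewrite /= ?rmorph1 ?rmorphM.
Qed.

HB.instance Definition _ :=
  GRing.isZmodMorphism.Build K emb_field emb_base emb_base_zmod_morphism.
HB.instance Definition _ :=
  GRing.isMonoidMorphism.Build K emb_field emb_base emb_base_monoid_morphism.

(** The embedding extends to the domain with [x] adjoined, and by maximality this extension already
    lies in [R]. *)
Lemma maximal_partial_emb_total :
  sep_closed L ->
  (forall R', partial_emb R' -> (R `<=` R')%classic -> (R' `<=` R)%classic) ->
  forall x, exists y, R (x, y).
Proof.
move=> Lcl Rmax x; have [h [h0 hsep hx]] := falg x.
pose i : {rmorphism emb_field -> L} := val.
pose s : {rmorphism emb_field -> L} := emb_val.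
have [|| y xy] := @root_transfer emb_field L i s x (map_poly emb_base h) Lcl.
- by rewrite separable_map.
- by rewrite -map_poly_comp.
exists y; apply: (Rmax _ (partial_emb_adjoin _ xy)).
- move=> k; exists (emb_base k); split=> //.
  by have [Rk _ _ _] := Re; apply: emb_val_eq; apply: Rk.
- move=> [a b] Rab.
  have da : emb_dom a by apply/asboolP; exists b.
  exists (Sub a da : emb_field)%:P; rewrite !map_polyC !hornerC /=.
  by congr pair; symmetry; apply: emb_val_eq.
- by exists 'X; rewrite !map_polyX !hornerX.
Qed.
End Domain.

(** * From embeddings to automorphisms; the fixed field *)

Hypothesis fsep : is_sep_closure f.

(** Only surjectivity needs algebraicity: the iterates of [g] at [y] are roots of one polynomial, so
    two of them coincide, and injectivity puts [y] in the image. *)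
Lemma embedding_in_GK (g : L -> L) :
  (forall x y, g (x + y) = g x + g y) -> (forall x y, g (x * y) = g x * g y) ->
  (forall k, g (f k) = f k) -> in_GK f g.
Proof.
move=> gD gM gf; have g1 : g 1 = 1 by rewrite -(rmorph1 f) gf.
have g0 : g 0 = 0 by rewrite -(rmorph0 f) gf.
have gB x y : g (x - y) = g x - g y.
  by apply: (addIr (g y)); rewrite -gD !subrK.
have ginj : injective g.
  move=> x y gxy.
  apply/eqP; rewrite -subr_eq0; apply/negPn/negP => xy0.
  have : g ((x - y) / (x - y)) = 1 by rewrite mulfV.
  rewrite gM gB gxy subrr mul0r => /eqP.
  by rewrite eq_sym oner_eq0.
split=> //.
have gsurj y : exists x, g x == y.
  have [p [p0 _ py]] := fsep.2 y.
  have groot x : root (map_poly f p) x -> root (map_poly f p) (g x).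
    have gp q : g (map_poly f q).[x] = (map_poly f q).[g x].
      elim/poly_ind: q => [|q c IH]; first by rewrite rmorph0 !horner0.
      rewrite rmorphD rmorphM /= map_polyX map_polyC /= !hornerMXaddC.
      by rewrite gD gM gf IH.
    by rewrite /root -gp => /eqP ->; rewrite g0.
  (* A nonzero polynomial [p] has fewer than [size p] distinct roots, so [size p] iterates force a
     repetition. *)
  pose o := [seq iter n g y | n <- iota 0 (size p)].
  have oroot : all (root (map_poly f p)) o.
    apply/allP => _ /mapP [n _ ->].
    by elim: n => //= n; apply: groot.
  have szo : size o = size p by rewrite size_map size_iota.
  have : ~~ uniq o.
    apply/negP => uo; have := max_poly_roots _ oroot uo.
    by rewrite map_poly_eq0 size_map_poly szo ltnn => /(_ p0).
  case/(uniqPn 0) => a [b [ab]]; rewrite szo => bp.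
  rewrite !(nth_map 0%N) ?size_iota ?(ltn_trans ab) // !nth_iota ?(ltn_trans ab) //.
  rewrite !add0n -(subnKC ab) addSnnS iterD.
  have itinj n : injective (iter n g) by elim: n => //= n IH u v /ginj /IH.
  move/itinj => ->.
  by exists (iter (b - a.+1) g y).
exists (fun y => xchoose (gsurj y)) => x; last first.
  by apply/eqP; apply: (xchooseP (gsurj x)).
by apply/ginj/eqP; apply: (xchooseP (gsurj (g x))).
Qed.

(** An [x] outside [K] has another conjugate [y]; the embedding [x |-> y], extended to all of [L],
    is an element of the Galois group that moves [x]. *)
Lemma fixed_field x : (forall g, in_GK f g -> g x = x) -> exists k, x = f k.
Proof.
move=> xfix; apply: contrapT => xK.
have [h [h0 hsep hx]] := fsep.2 x.
have [y yx xy] := other_conjugate fsep.1 hsep hx xK.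
have [|R [Re R0R Rmax]] := partial_emb_maximal (partial_emb_adjoin _ xy).
  by move=> k; exists k.
have tot := maximal_partial_emb_total Re fsep.2 fsep.1 Rmax.
pose g z := projT1 (cid (tot z)).
have gP z : R (z, g z) by exact: (projT2 (cid (tot z))).
have gE z z' : R (z, z') -> g z = z' by apply: partial_emb_fun (gP z).
have gx : g x = y.
  by apply/gE/R0R; exists 'X; rewrite !map_polyX !hornerX.
move/eqP: yx; apply; rewrite -gx; apply: xfix; apply: embedding_in_GK.
- by move=> a b; apply: gE; apply: partial_emb_add.
- by move=> a b; apply: gE; apply: partial_emb_mul.
- by move=> k; apply: gE; have [Rk _ _ _] := Re; apply: Rk.
Qed.
End Graph.

(** * Restrictions of Galois elements to a finite set, and independence of characters *)

Section GaloisGroup.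
Variables (K L : fieldType) (f : {rmorphism K -> L}).

Lemma in_GK_rmorph g : in_GK f g -> exists G : {rmorphism L -> L}, g = G.
Proof.
case=> gD gM g1 _ _.
have gB : zmod_morphism g.
  by move=> x y; apply: (addIr (g y)); rewrite -gD !subrK.
have gm : monoid_morphism g by [].
pose Gz := GRing.isZmodMorphism.Build L L g gB.
pose Gm := GRing.isMonoidMorphism.Build L L g gm.
pose G : {rmorphism L -> L} := HB.pack g Gz Gm.
by exists G.
Qed.

Lemma in_GK_id : in_GK f id.
Proof. by split=> //; exists id. Qed.

Lemma in_GK_comp g h : in_GK f g -> in_GK f h -> in_GK f (g \o h).
Proof.
move=> [gD gM g1 gb gf] [hD hM h1 hb hf]; split=> //=.
- by move=> x y; rewrite hD gD.
- by move=> x y; rewrite hM gM.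
- by rewrite h1.
- exact: bij_comp.
- by move=> k; rewrite hf gf.
Qed.

Lemma in_GK_base g k : in_GK f g -> g (f k) = f k.
Proof. by case. Qed.

Lemma roots_finite (p : {poly L}) :
  p != 0 -> exists T : seq L, forall z, root p z -> z \in T.
Proof.
elim: {p}(size p) {-2}p (leqnn (size p)) => [|n IHn] p.
  by rewrite leqn0 size_poly_eq0 => ->.
move=> szp p0; have [[z pz]|nz] := pselect (exists z, root p z); last first.
  by exists [::] => z pz; case: nz; exists z.
have /factor_theorem [q pE] := pz.
have q0 : q != 0 by apply: contraNneq p0 => q0; rewrite pE q0 mul0r.
have [|T qT] := IHn q _ q0.
  by move: szp; rewrite pE size_Mmonic ?monicXsubC // size_XsubC addn2.
exists (z :: T) => y; rewrite pE rootM root_XsubC in_cons.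
by case/orP=> [/qT ->|->]; rewrite ?orbT.
Qed.

Definition agree_on (S : seq L) (g h : L -> L) : Prop :=
  forall x, x \in S -> g x = h x.

(** Plays the part of membership in [K(S)], phrased through the Galois action alone. *)
Definition determined_by (S : seq L) (x : L) : Prop :=
  forall g h, in_GK f g -> in_GK f h -> agree_on S g h -> g x = h x.

Hypothesis fsep : is_sep_closure f.

(** A restriction to [S] is recorded as the tuple [map g S]. Each entry is a root of an annihilator
    of the corresponding element of [S], so finitely many tuples occur. *)
Lemma restrictions_finite (S : seq L) : exists ks : seq (seq L), uniq ks /\
  forall k, k \in ks <-> exists2 g, in_GK f g & map g S = k.
Proof.
have [T TP] : exists T : seq (seq L), forall g, in_GK f g -> map g S \in T.
  elim: S => [|x S [T TP]]; first by exists [:: [::]] => g; rewrite inE.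
  have [p [p0 _ px]] := fsep.2 x.
  have [|Z ZP] := @roots_finite (map_poly f p); first by rewrite map_poly_eq0.
  exists [seq y :: t | y <- Z, t <- T] => g gG /=.
  apply: allpairs_f; last exact: TP.
  apply: ZP; have gf := in_GK_base _ gG.
  have [G gE] := in_GK_rmorph gG.
  rewrite /root gE -[map_poly f p](_ : map_poly G (map_poly f p) = _).
    by rewrite horner_map (eqP (px : _ == 0)) rmorph0.
  by rewrite -map_poly_comp; apply: eq_map_poly => k /=; rewrite -gE gf.
exists (undup [seq k <- T | `[< exists2 g, in_GK f g & map g S = k >]]).
split=> [|k]; first exact: undup_uniq.
rewrite mem_undup mem_filter; split=> [/andP [/asboolP]//|].
move=> [g gG gk]; apply/andP; split; first by apply/asboolP; exists g.
by rewrite -gk TP.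
Qed.

Variables (S : seq L) (ks : seq (seq L)) (rep : seq L -> L -> L).
Hypothesis ks_uniq : uniq ks.
Hypothesis repG : forall k, k \in ks -> in_GK f (rep k).
Hypothesis repK : forall k, k \in ks -> map (rep k) S = k.

(** Composition with [h] permutes the tuples, and [h \o rep k] agrees on [S] with the representative
    of [map h k]. *)
Lemma sum_restrictions_translate (V : nmodType) (F : (L -> L) -> V) h :
  (forall g, in_GK f g -> map g S \in ks) ->
  (forall g g', in_GK f g -> in_GK f g' -> agree_on S g g' -> F g = F g') ->
  in_GK f h ->
  \sum_(k <- ks) F (h \o rep k) = \sum_(k <- ks) F (rep k).
Proof.
move=> ksP FS hG.
have hks : perm_eq (map (map h) ks) ks.
  have uh : uniq (map (map h) ks).
    rewrite map_inj_uniq //; apply: inj_map.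
    by case: hG => _ _ _ hb _; apply: bij_inj.
  have sub : {subset map (map h) ks <= ks}.
    move=> _ /mapP [k kk ->]; rewrite -{1}(repK kk) -map_comp.
    by apply: ksP; apply: in_GK_comp => //; apply: repG.
  apply: uniq_perm => //.
  by apply: (uniq_min_size uh sub _).2; rewrite size_map.
rewrite -[RHS](perm_big _ hks) /= big_map big_seq [RHS]big_seq.
apply: eq_bigr => k kk.
have hk : map h k \in ks by rewrite -(perm_mem hks) map_f.
apply: FS; [exact: in_GK_comp hG (repG kk)|exact: repG|].
apply/eq_in_map; rewrite (repK hk) -{2}(repK kk) -map_comp.
exact/eq_map.
Qed.

(** Artin's induction on the number of characters. Only test elements determined by [S] are used, so
    that the resulting sum depends on restrictions alone. *)
Lemma artin_independence (c : seq L -> L) k0 :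
  k0 \in ks -> c k0 != 0 ->
  exists2 t, determined_by S t & \sum_(k <- ks) c k * rep k t != 0.
Proof.
move=> k0k ck0; apply: contrapT => nt.
have {nt} c0 t : determined_by S t -> \sum_(k <- ks) c k * rep k t = 0.
  by move=> tS; apply/eqP/negPn/negP => n0; apply: nt; exists t.
move: ck0; apply/negP; rewrite negbK; apply/eqP.
elim: ks ks_uniq repG repK c c0 k0 k0k => //= k1 l IH /andP [k1l ul] lG lK c c0.
have k1G : in_GK f (rep k1) by apply: lG; rewrite mem_head.
have cl0 k : k \in l -> c k = 0.
  move=> kl; have kl1 : k \in k1 :: l by rewrite in_cons kl orbT.
  have [s sS ks1] : exists2 s, s \in S & rep k s != rep k1 s.
    apply: contrapT => ns; move/negP: k1l; apply.
    rewrite -(lK k1) ?mem_head // (_ : map _ _ = k) //.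
    rewrite -[RHS](lK k) //; apply/eq_in_map => s sS; apply/eqP.
    by rewrite eq_sym; apply/negPn/negP => ne; apply: ns; exists s.
  rewrite -subr_eq0 in ks1.
  suff : c k * (rep k s - rep k1 s) = 0.
    by move/eqP; rewrite mulf_eq0 (negPf ks1) orbF => /eqP.
  (* Take the relation at [s * t] minus [rep k1 s] times the relation at [t]: the term of [k1]
     cancels and a shorter relation remains. *)
  apply: (IH ul _ _ (fun k => c k * (rep k s - rep k1 s))) kl => {kl1 ks1 k}.
  - by move=> k kl; apply: lG; rewrite in_cons kl orbT.
  - by move=> k kl; apply: lK; rewrite in_cons kl orbT.
  move=> t tS.
  have stS : determined_by S (s * t).
    move=> g h gG hG gh; have [_ gM _ _ _] := gG; have [_ hM _ _ _] := hG.
    by rewrite gM hM (tS g h) // (gh s).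
  have := c0 _ tS; have := c0 _ stS; rewrite !big_cons => e1 e2.
  have : \sum_(j <- l) c j * rep j (s * t) -
         rep k1 s * \sum_(j <- l) c j * rep j t = 0.
    move/eqP: e1; rewrite addrC addr_eq0 => /eqP ->.
    move/eqP: e2; rewrite addrC addr_eq0 => /eqP ->.
    have [_ -> _ _ _] := k1G; ring.
  move=> e3; rewrite -[RHS]e3 mulr_sumr -sumrB big_seq [RHS]big_seq.
  apply: eq_bigr => j jl; have [|_ -> _ _ _] := lG j; last by ring.
  by rewrite in_cons jl orbT.
move=> k; rewrite in_cons => /orP [/eqP ->|]; last exact: cl0.
(* All other coefficients vanish, so the relation at [t = 1] reads [c k1 = 0]. *)
have := c0 1; rewrite big_cons big_seq big1 => [|j jl]; last first.
  by rewrite cl0 // mul0r.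
have [_ _ -> _ _] := k1G; rewrite addr0 mulr1; apply.
by move=> g h [_ _ -> _ _] [_ _ -> _ _].
Qed.
End GaloisGroup.

(** * Fourth roots of unity and square roots *)

Section FourthRootsOfUnity.
Variables (L : fieldType) (i : L).
Hypotheses (two_neq0 : 2%:R != 0 :> L) (i2 : i ^+ 2 = -1).

Definition zeta (n : 'Z_4) : L := i ^+ n.

Lemma i_expr4 : i ^+ 4 = 1.
Proof. by rewrite (exprM i 2 2) i2 sqrrN expr1n. Qed.

Lemma i_neq0 : i != 0.
Proof.
by apply: contra_eq_neq i2 => ->; rewrite expr0n eq_sym oppr_eq0 oner_eq0.
Qed.

Lemma zeta_neq0 n : zeta n != 0.
Proof. by rewrite expf_neq0 // i_neq0. Qed.

Lemma zetaD a b : zeta (a + b) = zeta a * zeta b.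
Proof. by rewrite /zeta -exprD; apply: expr_mod; apply: i_expr4. Qed.

Lemma zetaN a : zeta (- a) = (zeta a)^-1.
Proof.
apply: (mulfI (zeta_neq0 a)).
by rewrite -zetaD subrr mulfV ?zeta_neq0.
Qed.

Lemma neq_opp (x : L) : x != 0 -> x != - x.
Proof. by move=> x0; rewrite -addr_eq0 -mulr2n -mulr_natl mulf_neq0. Qed.

Lemma zeta_inj : injective zeta.
Proof.
move=> a b ab; apply/eqP; rewrite -subr_eq0; apply/eqP.
have : zeta (a - b) = 1 by rewrite zetaD zetaN ab mulfV ?zeta_neq0.
have i1 : i <> 1.
  by move=> i1; have /eqP[] := neq_opp (oner_neq0 L); rewrite -i2 i1 expr1n.
case: (a - b) => [[|[|[|[|//]]]] lt] /=; rewrite /zeta /= => e; apply: val_inj => //=.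
- by have /eqP[] := neq_opp (oner_neq0 L); rewrite -i2 -{1}e.
- by case: i1; have := i_expr4; rewrite exprSr e mul1r.
Qed.

Lemma zeta_surj x : x ^+ 4 = 1 -> exists n, x = zeta n.
Proof.
move=> x4; have : (x - 1) * (x + 1) * ((x - i) * (x + i)) = 0.
  rewrite -!subr_sqr i2 expr1n opprK -subr_sqr expr1n -exprM x4 subrr //.
move/eqP; rewrite !mulf_eq0 !subr_eq0 !addr_eq0 -!orbA.
case/or4P=> /eqP ->.
- by exists 0.
- by exists 2%:R; rewrite /zeta /= i2.
- by exists 1.
- by exists (-1); rewrite /zeta /= exprSr i2 mulN1r.
Qed.

Lemma sqr_eq_sign (x y : L) : x ^+ 2 = y ^+ 2 -> x = y \/ x = - y.
Proof.
move/eqP; rewrite eqf_sqr => /orP [/eqP|/eqP]; by [left|right].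
Qed.
End FourthRootsOfUnity.

(** The case [x = 0] is separate because ['X^2] is inseparable; otherwise the derivative [2 'X] is
    coprime to ['X^2 - x%:P]. *)
Lemma sep_closed_sqrt (L : fieldType) (x : L) :
  sep_closed L -> 2%:R != 0 :> L -> exists y, y ^+ 2 = x.
Proof.
move=> Lcl two; have [->|x0] := eqVneq x 0; first by exists 0; rewrite expr0n.
have szp : size ('X^2 - x%:P : {poly L}) = 3%N by rewrite size_XnsubC.
have [||y] := Lcl ('X^2 - x%:P); rewrite ?szp //.
  rewrite separable_poly.unlock derivB derivC subr0 derivXn /= -scaler_nat coprimepZr //.
  rewrite expr1 -[X in coprimep _ X]subr0 -polyC0 coprimep_XsubC /root.
  by rewrite !hornerE expr0n sub0r oppr_eq0.
by rewrite /root !hornerE subr_eq0 => /eqP; exists y.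
Qed.

(** * The twisted Galois action on [L * L] and its descent *)

Section Twist.
Variables (K L : fieldType) (f : {rmorphism K -> L}) (D : K) (r i : L).
Hypotheses (two_neq0 : 2%:R != 0 :> L) (r_neq0 : r != 0).
Hypotheses (r2 : r ^+ 2 = f D) (i2 : i ^+ 2 = -1).

Local Notation w := (i * r).
Local Notation e := (zeta i).

Lemma w_neq0 : w != 0. Proof. by rewrite mulf_neq0 // i_neq0. Qed.

Lemma w2 : w ^+ 2 = f (- D). Proof. by rewrite exprMn i2 r2 mulN1r rmorphN. Qed.

Lemma GK_i g : in_GK f g -> g i = i \/ g i = - i.
Proof.
move=> gG; have [G gE] := in_GK_rmorph gG; apply: sqr_eq_sign.
by rewrite gE -rmorphXn i2 rmorphN rmorph1.
Qed.

Lemma GK_r g : in_GK f g -> g r = r \/ g r = - r.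
Proof.
move=> gG; have [G gE] := in_GK_rmorph gG; apply: sqr_eq_sign.
by rewrite gE -rmorphXn r2 -gE (in_GK_base _ gG).
Qed.

Lemma GK_w g : in_GK f g -> g w = w \/ g w = - w.
Proof.
move=> gG; have [G gE] := in_GK_rmorph gG; apply: sqr_eq_sign.
by rewrite gE -rmorphXn w2 -gE (in_GK_base _ gG).
Qed.

Lemma GK_zeta g n : in_GK f g -> g (e n) = if g i == i then e n else e (- n).
Proof.
move=> gG; have gi := GK_i gG; have [G gE] := in_GK_rmorph gG.
rewrite /zeta gE rmorphXn -gE; case: eqP => [->//|gi'].
case: gi => [//|->]; rewrite -/(e (- n)) zetaN // -exprVn; congr (_ ^+ _).
by apply: (mulfI (i_neq0 i2)); rewrite mulfV ?i_neq0 // mulrN -expr2 i2 opprK.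
Qed.

Hypothesis fsep : is_sep_closure f.

(* The Galois action on the base change of [K[sqrt(-D)]] to [L], written in
   the coordinates [L * L] given by [a + b sqrt(-D) |-> (a + b w, a - b w)]. *)
Definition act (g : L -> L) (z : L * L) : L * L :=
  if g w == w then (g z.1, g z.2) else (g z.2, g z.1).

Definition zpair (n : 'Z_4) : L * L := (e n, e (- n)).

Definition qembed (p : K * K) : L * L := (f p.1 + f p.2 * w, f p.1 - f p.2 * w).

Lemma zpairD a b : zpair (a + b) = zpair a * zpair b.
Proof. by rewrite /zpair opprD !zetaD. Qed.

Lemma zpair0 : zpair 0 = 1. Proof. by rewrite /zpair oppr0. Qed.

Lemma zpair_cancel (z : L * L) : z.1 != 0 -> forall m n,
  zpair m * z = zpair n * z -> m = n.
Proof.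
by move=> z0 m n /(congr1 fst) /= /(mulIf z0) /(zeta_inj two_neq0 i2).
Qed.

Lemma chiactN g n : chiact r g (- n) = - chiact r g n.
Proof. by rewrite /chiact; case: ifP. Qed.

(** Moving [i] inverts roots of unity, and moving [w] swaps coordinates, which also inverts
    [zpair n]. The two effects leave an inversion exactly when [g] moves [r = w / i]. *)
Lemma act_zpair g n : in_GK f g -> act g (zpair n) = zpair (chiact r g n).
Proof.
move=> gG; have [_ gM _ _ _] := gG; rewrite /act /zpair /= !GK_zeta // opprK gM /chiact.
have ni := neq_opp two_neq0 (i_neq0 i2); have nr := neq_opp two_neq0 r_neq0.
have nw := neq_opp two_neq0 w_neq0.
case: (GK_i gG) => ->; case: (GK_r gG) => ->;
  by rewrite ?(mulrN, mulNr, opprK) ?eqxx ?(eq_sym (- _))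
    ?(negPf ni, negPf nr, negPf nw) // ?opprK.
Qed.

Lemma act_mul g y z : in_GK f g -> act g (y * z) = act g y * act g z.
Proof. by case=> _ gM _ _ _; rewrite /act; case: ifP => _; rewrite /= !gM. Qed.

Lemma act_expr4 g z : in_GK f g -> act g (z ^+ 4) = act g z ^+ 4.
Proof. by move=> gG; rewrite !exprS !expr0 !mulr1 !act_mul. Qed.

Lemma act_sum g (I : eqType) (s : seq I) (F : I -> L * L) : in_GK f g ->
  act g (\sum_(k <- s) F k) = \sum_(k <- s) act g (F k).
Proof.
move=> gG; have [G gE] := in_GK_rmorph gG.
have actD y z : act g (y + z) = act g y + act g z.
  by rewrite /act gE; case: ifP => _; rewrite /= !rmorphD.
have act0 : act g 0 = 0 by rewrite /act gE; case: ifP => _; rewrite /= rmorph0.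
by elim: s => [|k s IH]; rewrite ?big_nil // !big_cons actD IH.
Qed.

Lemma act_comp g h z : in_GK f g -> in_GK f h ->
  act (g \o h) z = act g (act h z).
Proof.
move=> gG hG; have [G gE] := in_GK_rmorph gG.
have nw := neq_opp two_neq0 w_neq0; have gw := GK_w gG.
rewrite /act /=; case: (GK_w hG) => ->; rewrite ?(eq_sym (- _)) ?eqxx ?(negPf nw) //=.
have -> : g (- w) = - g w by rewrite gE rmorphN.
by case: gw => ->; rewrite ?opprK ?(eq_sym (- _)) ?eqxx ?(negPf nw).
Qed.

Lemma act_eq g h z : g w = h w -> g z.1 = h z.1 -> g z.2 = h z.2 ->
  act g z = act h z.
Proof. by rewrite /act => -> -> ->. Qed.

Lemma act_prod g z : in_GK f g -> (act g z).1 * (act g z).2 = g (z.1 * z.2).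
Proof.
case=> _ gM _ _ _; rewrite /act; case: ifP => _ /=; rewrite gM //.
by rewrite mulrC.
Qed.

Lemma qembed_mul x y : qembed (qmul D x y) = qembed x * qembed y.
Proof.
have := w2; rewrite rmorphN expr2 /qembed /qmul => W.
congr pair => /=; rewrite rmorphB rmorphD !rmorphM /= -[f D]opprK -W; ring.
Qed.

Lemma qembed_norm x : (qembed x).1 * (qembed x).2 = f (qnorm D x).
Proof.
have := w2; rewrite rmorphN expr2 /qembed /qnorm => W /=.
rewrite rmorphD rmorphM !rmorphXn /= -[f D]opprK -W; ring.
Qed.

Lemma qembed_inj : injective qembed.
Proof.
case=> a b [a' b'] [e1 e2].
have ea : f a = f a'.
  apply: (mulfI two_neq0).
  have -> : 2%:R * f a = (f a + f b * w) + (f a - f b * w) by ring.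
  by rewrite e1 e2; ring.
move: e1; rewrite ea => /addrI /(mulIf w_neq0) eb.
by rewrite (fmorph_inj f ea) (fmorph_inj f eb).
Qed.

Lemma act_qembed g x : in_GK f g -> act g (qembed x) = qembed x.
Proof.
move=> gG; have [_ gM _ _ gf] := gG; have [G gE] := in_GK_rmorph gG.
have nw := neq_opp two_neq0 w_neq0.
rewrite /act /qembed /= gE !rmorphB !rmorphD !rmorphM -gE !gf -gM.
by case: (GK_w gG) => ->; rewrite ?(eq_sym (- _)) ?eqxx ?(negPf nw) // mulrN opprK.
Qed.

(** The half-sum of the coordinates and their half-difference over [w] are both Galois invariant:
    when [g] negates [w], the swap negates the difference as well. *)
Lemma act_fixed z :
  (forall g, in_GK f g -> act g z = z) -> exists x, z = qembed x.
Proof.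
move=> zfix.
have nw := neq_opp two_neq0 w_neq0.
have [a aE] : exists a, (z.1 + z.2) / 2%:R = f a.
  apply: (fixed_field fsep) => g gG; have := zfix _ gG.
  have [G gE] := in_GK_rmorph gG.
  rewrite /act gE fmorph_div rmorph_nat rmorphD.
  by case: ifP => _; case: z {zfix} => x y [-> ->] //=; rewrite addrC.
have [b bE] : exists b, (z.1 - z.2) / (2%:R * w) = f b.
  apply: (fixed_field fsep) => g gG; have := zfix _ gG.
  have gw := GK_w gG; have [G gE] := in_GK_rmorph gG.
  rewrite /act gE fmorph_div rmorphB (rmorphM _ 2%:R) rmorph_nat -gE.
  case: gw => ->; rewrite ?(eq_sym (- _)) ?eqxx ?(negPf nw);
    case: z {zfix aE} => x y [-> ->] //=.
  by rewrite mulrN invrN mulrN -mulNr opprB.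
have w0 := w_neq0.
exists (a, b); rewrite /qembed /= -aE -bE; case: z {zfix aE bE} => x y /=.
move: (i * r) w0 => v v0; congr pair; field; exact/andP.
Qed.

(** * Cocycles that become coboundaries of units, and Hilbert's theorem 90 *)

Definition trivializes (z : L * L) (s : (L -> L) -> 'Z_4) : Prop :=
  z.1 * z.2 != 0 /\ forall g, in_GK f g -> act g z = zpair (s g) * z.

Lemma zpair_prod n z : (zpair n * z).1 * (zpair n * z).2 = z.1 * z.2.
Proof. by rewrite /= mulrACA -zetaD // subrr mul1r. Qed.

Lemma zpair_expr4 n : zpair n ^+ 4 = 1.
Proof.
suff: zpair n ^+ 4 = (e n ^+ 4, e (- n) ^+ 4).
  by rewrite /zeta -!exprM !(mulnC _ 4) !exprM i_expr4 // !expr1n.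
by [].
Qed.

Lemma trivializes_uniq z s t g : trivializes z s -> trivializes z t ->
  in_GK f g -> s g = t g.
Proof.
move=> [z0 zs] [_ zt] gG; have := zs _ gG; rewrite (zt _ gG) => /esym.
by apply: zpair_cancel; move: z0; rewrite mulf_eq0 negb_or => /andP [].
Qed.

Lemma trivializes_zpair z s m : trivializes z s ->
  trivializes (zpair m * z) (fun g => s g + (chiact r g m - m)).
Proof.
move=> [z0 zs]; split=> [|g gG]; first by rewrite zpair_prod.
rewrite (act_mul _ _ gG) (act_zpair _ gG) // zs //.
by rewrite !mulrA -!zpairD // -(addrA (s g)) subrK addrC.
Qed.

Lemma trivializes_mul z s y t : trivializes z s -> trivializes y t ->
  trivializes (z * y) (fun g => s g + t g).
Proof.
move=> [z0 zs] [y0 yt]; split=> [|g gG]; first by rewrite /= mulrACA mulf_neq0.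
by rewrite (act_mul _ _ gG) zs // yt // mulrACA zpairD.
Qed.

Lemma trivializes_cohomologous z s y t m : trivializes z s -> trivializes y t ->
  y = zpair m * z -> cohomologous f r t s.
Proof.
move=> zs yt yE; exists m => g gG; rewrite yE in yt.
rewrite (trivializes_uniq yt (trivializes_zpair m zs) gG) addrC.
by rewrite addKr.
Qed.

Lemma trivializes_cocycle z s : trivializes z s -> cocycle f r s.
Proof.
move=> [z0 zs].
have z1 : z.1 != 0 by move: z0; rewrite mulf_eq0 negb_or => /andP [].
split=> [g h gG hG|].
  apply: (zpair_cancel z1); rewrite -zs; last exact: in_GK_comp.
  rewrite (act_comp _ gG hG) zs // act_mul //.
  by rewrite act_zpair // zs // mulrA -zpairD // addrC.
(* The image of [w] decides the swap; the other two give the coordinates of the conjugate. *)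
exists [:: w; z.1; z.2] => g h gG hG gh.
apply: (zpair_cancel z1); rewrite -!zs //.
by apply: act_eq; apply: gh; rewrite !inE eqxx ?orbT.
Qed.

(** The unit is the Poincare series of the twisted conjugates of [(t, 0)], summed over restrictions
    to a finite set that determines [s]. *)
Lemma hilbert90 s : cocycle f r s -> exists z, trivializes z s.
Proof.
(* Including [w] lets the restriction to [S] decide whether coordinates are swapped. *)
move=> [shom [S0 S0P]]; pose S := w :: S0.
have [ks [uks ksP]] := restrictions_finite fsep S.
have ksG g : in_GK f g -> map g S \in ks by move=> gG; apply/ksP; exists g.
have /choice [rep repP] : forall k, exists g, k \in ks -> in_GK f g /\ map g S = k.
  move=> k; have [/ksP [g gG gk]|kks] := boolP (k \in ks); first by exists g.
  by exists id.
have repG k : k \in ks -> in_GK f (rep k) by move=> /repP [].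
have repK k : k \in ks -> map (rep k) S = k by move=> /repP [].
(* These are the coefficients of the first coordinate of the series: a representative moving [w]
   sends [(t, 0)] to a pair with first entry 0. *)
pose c k := if rep k w == w then e (- s (rep k)) else 0.
have k0k : map id S \in ks by apply/ksG/in_GK_id.
have rw : rep (map id S) w = w by have /= [-> _] := repK _ k0k.
have ck0 : c (map id S) != 0 by rewrite /c rw eqxx zeta_neq0.
have [t tS tsum] := artin_independence uks repG repK k0k ck0.
pose F g := zpair (- s g) * act g (t, 0).
pose z := \sum_(k <- ks) F (rep k).
have FS g g' : in_GK f g -> in_GK f g' -> agree_on S g g' -> F g = F g'.
  move=> gG hG gg; rewrite /F (S0P g g') // => [|x xS]; last first.
    by apply: gg; rewrite in_cons xS orbT.
  congr (_ * _); apply: act_eq => /=; first by apply: gg; rewrite mem_head.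
    exact: tS.
  have [G ->] := in_GK_rmorph gG; have [H ->] := in_GK_rmorph hG.
  by rewrite !rmorph0.
have zs g : in_GK f g -> act g z = zpair (s g) * z.
  move=> gG.
  (* After reindexing the right side by [g \o rep k], the cocycle identity cancels the factor
     [zpair (s g)]. *)
  rewrite [in RHS]/z -(sum_restrictions_translate uks repG repK ksG FS gG).
  rewrite mulr_sumr /z act_sum // big_seq [RHS]big_seq; apply: eq_bigr => k kk.
  have kG := repG k kk; rewrite /F act_mul // act_zpair //.
  rewrite mulrA -zpairD // shom // opprD addrA subrr add0r.
  by rewrite chiactN act_comp.
have z1 : z.1 != 0.
  move: tsum; rewrite (_ : \sum_(k <- ks) _ = z.1) // /z.
  rewrite (big_morph fst (id1 := 0) (op1 := +%R)) // big_seq [RHS]big_seq.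
  apply: eq_bigr => k kk; rewrite /F /c /act; case: eqP => _ //=.
  have [G ->] := in_GK_rmorph (repG k kk).
  by rewrite rmorph0 mulr0 mul0r.
(* Artin's lemma controls only [z.1]. An element moving [w] carries [z.2] to a nonzero multiple of
   [z.1], so [z.2] is nonzero too. *)
have [[g gG gw]|gw] := pselect (exists2 g, in_GK f g & g w != w).
  exists z; split=> //; rewrite mulf_neq0 //.
  have := zs g gG; have [G gE] := in_GK_rmorph gG.
  rewrite /act (negPf gw) gE => /(congr1 fst) /= zE.
  by rewrite -(fmorph_eq0 G) zE mulf_neq0 ?zeta_neq0.
(* If nothing moves [w], the series has second coordinate 0. The action is then componentwise, and
   [z.1^-1] transforms by the inverse root of unity, as required. *)
exists (z.1, z.1^-1); split=> [|g gG]; first by rewrite /= mulfV ?oner_neq0.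
have := zs g gG; have [G gE] := in_GK_rmorph gG.
have gww : g w = w by apply/eqP/negPn/negP => ne; apply: gw; exists g.
rewrite /act gww eqxx gE fmorphV => /(congr1 fst) /= ->.
by rewrite /zpair zetaN // invfM.
Qed.

(** * Fourth roots of pairs and the cocycles they define *)

Definition quartic_root (p : (K * K) * K) (z : L * L) : Prop :=
  z ^+ 4 = qembed p.1 /\ z.1 * z.2 = f p.2.

(** Two square roots give the first coordinate [x]; the second must be [c / x], and [N alpha = c^4]
    makes its fourth power correct. *)
Lemma quartic_root_exists p : inP D p -> exists z, quartic_root p z.
Proof.
move=> [n0 [c0 nc]].
have [y yE] := sep_closed_sqrt (qembed p.1).1 fsep.1 two_neq0.
have [x xE] := sep_closed_sqrt y fsep.1 two_neq0.
have x4 : x ^+ 4 = (qembed p.1).1 by rewrite (exprM x 2 2) xE yE.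
have N := qembed_norm p.1.
have p0 : (qembed p.1).1 != 0.
  apply: contraNneq n0 => p0; move: N; rewrite p0 mul0r => /esym/eqP.
  by rewrite fmorph_eq0.
have x0 : x != 0 by apply: contraNneq p0 => x0; rewrite -x4 x0 expr0n.
exists (x, f p.2 / x); split; last by rewrite /= mulrC divfK.
rewrite [LHS](_ : _ = (x ^+ 4, (f p.2 / x) ^+ 4)) //.
rewrite expr_div_n x4 -rmorphXn -nc -N mulrAC mulfV // mul1r.
by case: (qembed _).
Qed.

Lemma quartic_root_neq0 p z : inP D p -> quartic_root p z -> z.1 * z.2 != 0.
Proof. by move=> [_ [c0 _]] [_ ->]; rewrite fmorph_eq0. Qed.

(** The first coordinates differ by a fourth root of unity, and the prescribed product forces the
    inverse factor on the second. *)
Lemma quartic_root_ratio p z y : inP D p -> quartic_root p z ->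
  quartic_root p y -> exists n, y = zpair n * z.
Proof.
move=> pP zp yp; have := quartic_root_neq0 pP zp; have := quartic_root_neq0 pP yp.
rewrite !mulf_eq0 !negb_or => /andP [y1 y2] /andP [z1 z2].
have [z4 zc] := zp; have [y4 yc] := yp.
have [n yz] : exists n, y.1 / z.1 = e n.
  apply: (zeta_surj i2); rewrite expr_div_n.
  have : (y ^+ 4).1 = (z ^+ 4).1 by rewrite y4 z4.
  rewrite -[(y ^+ 4).1]/(y.1 ^+ 4) -[(z ^+ 4).1]/(z.1 ^+ 4) => ->.
  by rewrite mulfV ?expf_neq0.
have y1E : y.1 = e n * z.1 by rewrite -yz divfK.
exists n; rewrite [LHS]surjective_pairing; congr pair => //=.
apply: (mulfI y1); rewrite yc -zc {1}y1E [RHS]mulrACA -zetaD // subrr mul1r.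
by rewrite mulrC.
Qed.

Lemma quartic_root_act p z g : in_GK f g -> quartic_root p z ->
  quartic_root p (act g z).
Proof.
move=> gG [z4 zc]; split; last by rewrite act_prod // zc (in_GK_base _ gG).
by rewrite -act_expr4 // z4 act_qembed.
Qed.

Lemma quartic_root_zpair p z m : quartic_root p z -> quartic_root p (zpair m * z).
Proof.
by move=> [z4 zc]; split; rewrite ?zpair_prod // exprMn zpair_expr4 mul1r.
Qed.

Lemma quartic_root_mul p q z y : quartic_root p z -> quartic_root q y ->
  quartic_root (pmul D p q) (z * y).
Proof.
move=> [z4 zc] [y4 yc]; split.
  by rewrite exprMn z4 y4 qembed_mul.
by rewrite /= mulrACA zc yc rmorphM.
Qed.

(** For [g] in the Galois group, [act g z] is again a fourth root of [p], so the search succeeds;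
    the default 0 can occur only outside the group. *)
Lemma quartic_root_trivializes p z : inP D p -> quartic_root p z ->
  trivializes z (fun g => odflt 0 [pick n | act g z == zpair n * z]).
Proof.
move=> pP zp; split=> [|g gG]; first exact: quartic_root_neq0 zp.
have [n nE] := quartic_root_ratio pP zp (quartic_root_act gG zp).
by case: pickP => [m /eqP //|/(_ n)]; rewrite nE eqxx.
Qed.

Lemma qembed_pow4 b : qembed (qpow4 D b) = qembed b ^+ 4.
Proof. by rewrite /qpow4 !qembed_mul !exprS expr0 mulr1 !mulrA. Qed.

(** If [s] is the coboundary of [m], then [zpair (- m) * z] is fixed and descends to [beta].
    Conversely, [beta] is a fourth root of [p] with zero cocycle, and [z] differs from it by some
    [zpair n]. *)
Lemma quartic_root_inS p z s : inP D p -> quartic_root p z -> trivializes z s ->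
  coboundary f r s <-> inS D p.
Proof.
move=> pP zp zs; split=> [[m sm]|[b [b0 p1 p2]]].
  have [n0 tr] := trivializes_zpair (- m) zs.
  have [|b bE] := act_fixed (z := zpair (- m) * z).
    move=> g gG; rewrite tr // sm // chiactN opprK addrACA subrr addNr addr0.
    by rewrite zpair0 mul1r.
  have [b4 bc] := quartic_root_zpair (- m) zp.
  have N := qembed_norm b.
  exists b; split.
  - by rewrite -(fmorph_eq0 f) -N -bE.
  - apply: qembed_inj.
    by rewrite qembed_pow4 -bE b4.
  - by apply: (fmorph_inj f); rewrite -N -bE bc.
have br : quartic_root p (qembed b).
  by split; [rewrite p1 qembed_pow4|rewrite p2 qembed_norm].
have [n zE] := quartic_root_ratio pP br zp.
exists n => g gG.
have bt : trivializes (qembed b) (fun=> 0).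
  split=> [|h hG]; first by rewrite qembed_norm // fmorph_eq0.
  by rewrite act_qembed // zpair0 mul1r.
rewrite zE in zs.
by rewrite (trivializes_uniq zs (trivializes_zpair n bt) gG) add0r.
Qed.

(** Factors [zpair n] disappear from both [z ^+ 4] and [z.1 * z.2], so these are fixed and descend
    to a pair. *)
Lemma trivializes_quartic_root z s : trivializes z s ->
  exists2 p, inP D p & quartic_root p z.
Proof.
move=> [z0 zs].
have [b bE] : exists b, z ^+ 4 = qembed b.
  apply: (act_fixed) => g gG.
  by rewrite act_expr4 // zs // exprMn zpair_expr4 mul1r.
have [c cE] : exists c, z.1 * z.2 = f c.
  apply: (fixed_field fsep) => g gG.
  by rewrite -(act_prod _ gG) zs // zpair_prod.
have N : qnorm D b = c ^+ 4.
  apply: (fmorph_inj f); rewrite -(qembed_norm) -bE rmorphXn -cE exprMn.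
  by [].
have c0 : c != 0 by rewrite -(fmorph_eq0 f) -cE.
by exists (b, c); split=> //; rewrite N expf_neq0.
Qed.

(* The coordinates of [L] are read off from a fourth root [z = (s, t)] of
   [(a + b sqrt(-D), c)]: since [s t = c], one has [(s^2 + t^2)^2 = 2a + 2c^2]
   and [(s + t)^2 = 2c + (s^2 + t^2)]. *)
Definition coord (z : L * L) : L * L := (z.1 ^+ 2 + z.2 ^+ 2, z.1 + z.2).

Lemma coord_GK g z : in_GK f g -> (g (coord z).1, g (coord z).2) = coord (act g z).
Proof.
move=> gG; have [G ->] := in_GK_rmorph gG.
rewrite /coord /act; case: ifP => _ /=; rewrite !rmorphD !rmorphXn //.
by congr pair; apply: addrC.
Qed.

Lemma coord_Lhom a b c z : quartic_root ((a, b), c) z -> is_Lhom f a c (coord z).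
Proof.
case: z => s t [z4 /= st].
have [s4 t4] : s ^+ 4 = f a + f b * w /\ t ^+ 4 = f a - f b * w.
  by have := z4; rewrite [LHS](_ : _ = (s ^+ 4, t ^+ 4)) // => -[].
split=> /=; last by rewrite rmorphM rmorph_nat -st; ring.
rewrite rmorphD !rmorphM /= rmorph_nat -st.
have -> : 2%:R * f a = s ^+ 4 + t ^+ 4 by rewrite s4 t4; ring.
ring.
Qed.

(** [zpair 1] is [(i, -i)], with square [(-1, -1)]: it passes to the other square root [u], whereas
    [zpair 2] keeps [u] and negates [v]. *)
Lemma coord_zpair1 z : coord (zpair 1 * z) =
  (- (coord z).1, i * (z.1 - z.2)).
Proof.
have e1 : e 1 = i by [].
have eN : e (-1) = - i by rewrite /zeta /= exprSr i2 mulN1r.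
rewrite /coord /= e1 eN !exprMn sqrrN i2; congr pair; ring.
Qed.

Lemma coord_zpair2 z : coord (zpair 2%:R * z) = ((coord z).1, - (coord z).2).
Proof.
have e1 : e 2%:R = -1 by rewrite /zeta /= i2.
have eN : e (- 2%:R) = -1 by rewrite /zeta /= i2.
rewrite /coord /= e1 eN; congr pair; ring.
Qed.

(** Odd [n] negates [u], and [n = 2] negates [v]; neither is harmless when [u] and [v] are
    nonzero. *)
Lemma coord_zpair_inj z : (coord z).1 != 0 -> (coord z).2 != 0 ->
  forall n, coord (zpair n * z) = coord z -> n = 0.
Proof.
move=> u0 v0.
have odd1 y : (coord y).1 != 0 -> (coord (zpair 1 * y)).1 = (coord y).1 -> False.
  move=> y0; rewrite coord_zpair1 /= => /eqP.
  by rewrite eq_sym (negPf (neq_opp two_neq0 y0)).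
case=> [[|[|[|[|//]]]] lt] nE; apply/val_inj => //=; exfalso.
- have := congr1 fst nE; rewrite (_ : Ordinal lt = 1); last exact: val_inj.
  exact: odd1 u0.
- have := nE; rewrite (_ : Ordinal lt = 2%:R) ?coord_zpair2; last exact: val_inj.
  case: (coord z) v0 => u v /= v0 [/eqP].
  by rewrite eq_sym (negPf (neq_opp two_neq0 v0)).
- apply: (odd1 (zpair 2%:R * z)); first by rewrite coord_zpair2.
  have := congr1 fst nE; rewrite (_ : Ordinal lt = 1 + 2%:R); last exact: val_inj.
  by rewrite zpairD -mulrA coord_zpair2.
Qed.

(** Choose [n] among 0 and 1 to match the sign of [u], then add 2 if the sign of [v] is wrong. *)
Lemma coord_zpair_surj a b c z uv : quartic_root ((a, b), c) z ->
  is_Lhom f a c uv -> exists n, coord (zpair n * z) = uv.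
Proof.
move=> zp [u2 v2].
have sgn n : uv.1 = (coord (zpair n * z)).1 -> exists n, coord (zpair n * z) = uv.
  move=> uE; have [_] := coord_Lhom (quartic_root_zpair n zp).
  rewrite -uE -v2 => /sqr_eq_sign [vE|vE].
    by exists n; rewrite [LHS]surjective_pairing -uE vE -surjective_pairing.
  exists (2%:R + n); rewrite zpairD -mulrA coord_zpair2 -uE vE opprK.
  by rewrite -surjective_pairing.
have [uz _] := coord_Lhom zp; move: u2; rewrite -uz => /sqr_eq_sign [uE|uE].
  by apply: (sgn 0); rewrite zpair0 mul1r.
by apply: (sgn 1); rewrite coord_zpair1.
Qed.

(** The label [x] goes to the coordinates of [zpair x * z], which [g] carries to those of
    [zpair (chiact r g x + s g) * z]. The two inequalities give [u] and [v] nonzero, hence four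
    distinct coordinates. *)
Lemma quartic_root_labels a b c z s : quartic_root ((a, b), c) z ->
  trivializes z s -> 2%:R * a + 2%:R * c ^+ 2 != 0 ->
  2%:R * a + 2%:R * c ^+ 2 != 4%:R * c ^+ 2 -> labels f r s a c.
Proof.
move=> zp zs ac0 ac1; exists (fun x => coord (zpair x * z)); split.
- move=> x y xy; apply/eqP; rewrite -subr_eq0; apply/eqP.
  have [u2 v2] := coord_Lhom (quartic_root_zpair y zp).
  apply: (@coord_zpair_inj (zpair y * z)).
  + apply: contraNneq ac0 => u0; move: u2; rewrite u0 expr0n => /esym/eqP.
    by rewrite fmorph_eq0.
  + apply: contraNneq ac1 => v0; move: v2; rewrite v0 expr0n addrC => /esym/eqP.
    rewrite addr_eq0 => /eqP u0; move: u2; rewrite u0 sqrrN -rmorphXn.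
    by move/(fmorph_inj f) => <-; apply/eqP; ring.
  by rewrite mulrA -zpairD subrK.
- by move=> x; apply: coord_Lhom (quartic_root_zpair x zp).
- by move=> uv /(coord_zpair_surj zp).
move=> g x gG; rewrite coord_GK // act_mul // act_zpair // zs.2 //.
by rewrite mulrA -zpairD.
Qed.
End Twist.

(** The isomorphism is expressed on representatives: [Phi] is additive up to coboundaries, has the
    prescribed kernel, and meets every class. The two inequalities in the last clause say that [L]
    is etale. *)
Theorem theorem5p5 (K Ksep : fieldType) (f : {rmorphism K -> Ksep}) (D : K) (r : Ksep) :
  2%:R != 0 :> K -> D != 0 -> is_sep_closure f -> r ^+ 2 = f D ->
  exists Phi : (K * K) * K -> ((Ksep -> Ksep) -> 'Z_4),
    [/\ (* each Phi p is a continuous crossed homomorphism *)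
        forall p, inP D p -> cocycle f r (Phi p),
        (* Phi is a homomorphism modulo coboundaries *)
        forall p q, inP D p -> inP D q ->
          cohomologous f r (Phi (pmul D p q)) (fun g => Phi p g + Phi q g),
        (* kernel is exactly the subgroup {(beta^4, N beta)} *)
        forall p, inP D p -> (coboundary f r (Phi p) <-> inS D p),
        (* surjective onto H^1(K, M) *)
        forall s, cocycle f r s -> exists2 p, inP D p & cohomologous f r s (Phi p)
      & (* the coclass of (a + b sqrt(-D), c) corresponds to the quartic algebra L *)
        forall a b c, inP D ((a, b), c) ->
          2 * a + 2 * c ^+ 2 != 0 -> 2 * a + 2 * c ^+ 2 != 4 * c ^+ 2 ->
          exists s, cohomologous f r s (Phi ((a, b), c)) /\ labels f r s a c].
Proof.
move=> two D0 fsep r2.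
have two' : 2%:R != 0 :> Ksep by rewrite -(rmorph_nat f) fmorph_eq0.
have r0 : r != 0.
  by apply: contra_eq_neq r2 => ->; rewrite expr0n eq_sym fmorph_eq0.
have [i i2] := sep_closed_sqrt (-1) fsep.1 two'.
(* One fourth root is chosen for each pair; 0 is a filler where [inP D p] fails. *)
have /choice [z zP] : forall p, exists z, inP D p -> quartic_root f r i p z.
  move=> p; have [pP|pP] := pselect (inP D p); last by exists 0.
  by have [z zp] := quartic_root_exists two' r2 i2 fsep pP; exists z.
have Phi_triv p (pP : inP D p) := quartic_root_trivializes two' r0 r2 i2 pP (zP p pP).
pose Phi p g := odflt 0 [pick n | act r i g (z p) == zpair i n * z p].
exists Phi; split.
- by move=> p pP; apply: (trivializes_cocycle two' r0 r2 i2 (Phi_triv p pP)).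
- move=> p q pP qP.
  have pqP : inP D (pmul D p q).
    have [[p1 [p2 pN]] [q1 [q2 qN]]] := (pP, qP).
    have qM : qnorm D (qmul D p.1 q.1) = qnorm D p.1 * qnorm D q.1.
      by rewrite /qnorm /qmul /=; ring.
    by split; rewrite /= ?qM ?mulf_neq0 // pN qN exprMn; split.
  (* [z p * z q] and the root chosen for the product are fourth roots of the same pair, so they
     differ by an element of [M]. *)
  have pqr := quartic_root_mul r2 i2 (zP p pP) (zP q qP).
  have [m zE] := quartic_root_ratio i2 pqP pqr (zP _ pqP).
  apply: (trivializes_cohomologous two' r0 r2 i2 _ (Phi_triv _ pqP) zE).
  exact: (trivializes_mul i2 (Phi_triv p pP) (Phi_triv q qP)).
- by move=> p pP; apply: (quartic_root_inS two' r0 r2 i2 fsep pP (zP p pP)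
                   (Phi_triv p pP)).
(* The unit [y] trivializing [s] is a fourth root of some [p]; comparing it with [z p] compares [s]
   with [Phi p]. *)
- move=> s /(hilbert90 two' r0 r2 i2 fsep) [y ys].
  have [p pP yp] := trivializes_quartic_root two' r0 r2 i2 fsep ys.
  exists p => //; have [m yE] := quartic_root_ratio i2 pP (zP p pP) yp.
  exact: (trivializes_cohomologous two' r0 r2 i2 (Phi_triv p pP) ys yE).
- move=> a b c pP ac0 ac1; exists (Phi ((a, b), c)); split.
    by exists 0 => g _; rewrite subr0 subrr /chiact oppr0 if_same.
  exact: (quartic_root_labels two' r0 r2 i2 (zP _ pP) (Phi_triv _ pP) ac0 ac1).
Qed.
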